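(* Let $q$ be a prime power, $r,n$ positive integers with $rn$ even, $V$ an $r$-dimensional $\mathbb{F}_{q^n}$-vector space, and $U$ an $\mathbb{F}_q$-subspace of $V$ with $\dim_{\mathbb{F}_q}U=rn/2$. Let $i=\max\{\dim_{\mathbb{F}_q}(U\cap\langle v\rangle_{\mathbb{F}_{q^n}}) : v\in V\}$. Let $W$ be an $\mathbb{F}_q$-vector space of dimension $rn/2$ and $G:V\to W$ an $\mathbb{F}_q$-linear map with $\ker G=U$. For $v\in V$ let $\tau_v:\mathbb{F}_{q^n}\to V$, $\lambda\mapsto\lambda v$. If $i<n$, then $$\mathcal{C}_{U,G}=\{G\circ\tau_v : v\in V\}$$ is an $\mathbb{F}_q$-linear rank distance code of $\mathbb{F}_q$-linear maps $\mathbb{F}_{q^n}\to W$ (i.e. of $(rn/2)\times n$ matrices over $\mathbb{F}_q$) of $\mathbb{F}_q$-dimension $rn$ and with parameters $(rn/2,n,q;n-i)$. Moreover, $\mathcal{C}_{U,G}$ is an MRD-code if and only if $U$ is a maximum scattered $\mathbb{F}_q$-subspace with respect to $\mathbb{F}_{q^n}$, i.e. $\dim_{\mathbb{F}_q}(U\cap\langle v\rangle_{\mathbb{F}_{q^n}})\leq 1$ for every nonzero $v\in V$.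
   Context: A rank distance (RD-) code is a subset $\mathcal{C}$ of $\mathbb{F}_q^{m\times n'}$ (equivalently of $\mathbb{F}_q$-linear maps between $\mathbb{F}_q$-spaces of dimensions $n'$ and $m$) with distance $d(A,B)=\mathrm{rk}(A-B)$; its minimum distance is $d(\mathcal{C})=\min_{A\neq B\in\mathcal{C}}d(A,B)$. An $\mathbb{F}_q$-linear code (an $\mathbb{F}_q$-subspace) with minimum distance $d$ has parameters $(m,n',q;d)$. The Singleton bound is $|\mathcal{C}|\leq q^{\max\{m,n'\}(\min\{m,n'\}-d+1)}$, and $\mathcal{C}$ is an MRD-code if equality holds.
   Formalization: The implication ''MRD implies U scattered'' is stated only for r > 1 or n = 2, since it fails for r = 1 and every even n ≥ 4 (there the code is MRD with i = n/2 ≥ 2); everything else, including ''scattered implies MRD'', is stated for all r, n. *)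

(* Defs.v *)
From HB Require Import structures.
From mathcomp Require Import all_boot all_algebra all_field.

Set Implicit Arguments.
Unset Strict Implicit.
Unset Printing Implicit Defensive.

Import GRing.Theory.
Local Open Scope ring_scope.

(* Restriction of scalars: an L-space V regarded as an F-space, where L is a
   finite extension of F.  The carrier is V itself; a : F acts as a%:A : L. *)
Section RestrictScalars.

Variables (F : fieldType) (L : fieldExtType F) (V : vectType L).

Definition restrict : Type := V.

HB.instance Definition _ := GRing.Zmodule.on restrict.

Definition restrict_scale (a : F) (u : restrict) : restrict :=
  (a%:A : L) *: (u : V).

Fact restrict_scaleA a b u :
  restrict_scale a (restrict_scale b u) = restrict_scale (a * b) u.
Proof. by rewrite [LHS]scalerA -[_ * _](rmorphM (in_alg L)). Qed.

Fact restrict_scale1 u : restrict_scale 1 u = u.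
Proof. by rewrite /restrict_scale !scale1r. Qed.

Fact restrict_scaleDr a u v :
  restrict_scale a (u + v) = restrict_scale a u + restrict_scale a v.
Proof. exact: scalerDr. Qed.

Fact restrict_scaleDl v a b :
  restrict_scale (a + b) v = restrict_scale a v + restrict_scale b v.
Proof. by rewrite /restrict_scale scalerDl (@scalerDl L V). Qed.

HB.instance Definition _ := GRing.Zmodule_isLmodule.Build F restrict
  restrict_scaleA restrict_scale1 restrict_scaleDr restrict_scaleDl.

Lemma restrict_scaleE (a : F) (u : V) :
  a *: (u : restrict) = (a%:A : L) *: u :> V.
Proof. by []. Qed.

Fact restrict_vect_iso :
  {v2r : restrict -> 'rV[F]_(\dim {:V} * \dim {:L}) |
    linear v2r & bijective v2r}.
Proof.
set m := \dim {:V}; set n := \dim {:L}.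
pose bV : m.-tuple V := vbasis {:V}; pose bL : n.-tuple L := vbasis {:L}.
pose v2r (x : restrict) := mxvec (\matrix_(i, j) coord bL j (coord bV i x)).
have v2r_lin: linear v2r.
  move=> a x y; rewrite -linearP; congr mxvec; apply/matrixP=> i j.
  by rewrite !mxE linearP /= mulr_algl linearP.
pose r2v r : restrict :=
  \sum_(i < m) (\sum_(j < n) vec_mx r i j *: bL`_j) *: bV`_i.
have v2rK: cancel v2r r2v.
  move=> x; transitivity (\sum_(i < m) coord bV i x *: bV`_i); last first.
    by rewrite -coord_vbasis ?memvf.
  apply: eq_bigr => i _; rewrite mxvecK; congr (_ *: _ : V).
  rewrite (coord_vbasis (memvf (coord bV i x))).
  by apply: eq_bigr => j _; rewrite mxE.
exists v2r => //; exists r2v => // r.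
apply: (canLR vec_mxK); apply/matrixP=> i j; rewrite mxE.
by rewrite !coord_sum_free ?(basis_free (vbasisP _)).
Qed.

HB.instance Definition _ := Lmodule_hasFinDim.Build F restrict restrict_vect_iso.

Lemma dim_restrict : \dim {:restrict} = (\dim {:V} * \dim {:L})%N.
Proof. by rewrite dimvf. Qed.

Definition tau_fun (v : V) (a : L) : restrict := a *: v.

Fact tau_is_linear v : linear (tau_fun v).
Proof.
move=> c a b; rewrite /tau_fun (@scalerDl L V) restrict_scaleE.
by rewrite (@scalerA L V) mulr_algl.
Qed.

HB.instance Definition _ v :=
  GRing.isLinear.Build F L restrict _ (tau_fun v) (@tau_is_linear v).

Definition tau (v : V) : 'Hom(L, restrict) := linfun (tau_fun v).

Lemma tauE v a : tau v a = a *: v.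
Proof. exact: lfunE. Qed.

(* The L-line <v>_L = {a *: v | a : L}, as an F-subspace of V. *)
Definition Lline (v : V) : {vspace restrict} := limg (tau v).

Lemma mem_Lline (u v : V) : (u \in Lline v) = (u \in <[v]>%VS).
Proof.
apply/memv_imgP/vlineP => [[a _ ->] | [a ->]]; first by exists a; rewrite tauE.
by exists a; rewrite ?memvf // tauE.
Qed.

Definition scattered (U : {vspace restrict}) : Prop :=
  forall v : V, v != 0 -> (\dim (U :&: Lline v) <= 1)%N.

End RestrictScalars.

Arguments restrict {F L} V.

Definition is_max_value (T : Type) (f : T -> nat) (k : nat) : Prop :=
  (exists x, f x = k) /\ (forall x, f x <= k)%N.

(* Codes are finite sets of F-linear maps aT -> rT, that is, of
   (\dim rT) x (\dim aT) matrices; finvect_type only provides the canonical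
   finType structure on 'Hom(aT, rT). *)
Section RankDistanceCodes.

Variables (F : finFieldType) (aT rT : vectType F).
Implicit Type C : {set finvect_type 'Hom(aT, rT)}.

Definition rank_dist (A B : 'Hom(aT, rT)) : nat := \dim (limg (A - B)).

Definition is_min_dist C (d : nat) : Prop :=
  (exists A B, [/\ A \in C, B \in C, A != B & rank_dist A B = d]) /\
  (forall A B, A \in C -> B \in C -> A != B -> (d <= rank_dist A B)%N).

Definition linear_code C : Prop := exists X : {vspace 'Hom(aT, rT)}, C =i X.

Definition code_dim C : nat := \dim (span (enum C : seq 'Hom(aT, rT))).

Definition has_parameters C (m n q d : nat) : Prop :=
  [/\ linear_code C, \dim {:rT} = m, \dim {:aT} = n, #|F| = q & is_min_dist C d].

Definition MRD C : Prop :=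
  let m := \dim {:rT} in let n := \dim {:aT} in
  exists2 d, is_min_dist C d
           & #|C| = (#|F| ^ (maxn m n * (minn m n - d + 1)))%N.

End RankDistanceCodes.

(* C_{U,G} with U = lker G *)
Definition code_of (F : finFieldType) (L : fieldExtType F) (V : vectType L)
    (W : vectType F) (G : 'Hom(restrict V, W)) :
    {set finvect_type 'Hom(L, W)} :=
  [set ((G \o tau v)%VF : finvect_type _) | v : finvect_type (restrict V)].

(* Main.v *)
Require Import Defs.
From HB Require Import structures.
From mathcomp Require Import all_boot all_algebra all_field.

Set Implicit Arguments.
Unset Strict Implicit.
Unset Printing Implicit Defensive.

Import GRing.Theory.
Local Open Scope ring_scope.

(* The map v |-> G o tau_v is F_q-linear, and for v != 0 its value has kernel
   isomorphic to U :&: <v>, hence rank n - dim (U :&: <v>).  As i < n, no value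
   with v != 0 vanishes, so the code is a copy of V; its minimum distance n - i
   turns the Singleton equality into (rn/2)(i + 1) = rn, that is i = 1. *)

Section CodeOf.

Variables (F : finFieldType) (L : fieldExtType F) (V : vectType L).
Variables (W : vectType F) (G : 'Hom(restrict V, W)).

Definition encode (v : restrict V) : 'Hom(L, W) := (G \o tau v)%VF.

Lemma encodeE (v : V) (a : L) : encode v a = G (a *: v).
Proof. by rewrite comp_lfunE tauE. Qed.

(** [G] is only F-linear, but multiplication in [L] is commutative: a scalar [c] from [F] moves past
    [a] in [a *: v] and then through [G]. *)
Fact encode_is_linear : linear encode.
Proof.
move=> c u v; apply/lfunP => a.
rewrite add_lfunE scale_lfunE !encodeE -linearP; congr (G _).
rewrite (@scalerDr L V); congr (_ + _).
by rewrite !restrict_scaleE !(@scalerA L V) mulrC.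
Qed.

HB.instance Definition _ :=
  GRing.isLinear.Build F (restrict V) 'Hom(L, W) _ encode encode_is_linear.

Lemma lker_tau (v : V) : v != 0 -> lker (tau v) = 0%VS.
Proof.
move=> v_neq0; apply/eqP/lker0P => a b; rewrite !tauE => /eqP.
rewrite -subr_eq0 -(@scalerBl L V) (@scaler_eq0 L V) (negPf v_neq0) orbF.
by rewrite subr_eq0 => /eqP.
Qed.

Lemma dim_Lline (v : V) : v != 0 -> \dim (Lline v) = \dim {:L}.
Proof. by move=> v_neq0; rewrite limg_dim_eq // lker_tau // capv0. Qed.

Lemma Lline0 : Lline (0 : V) = 0%VS.
Proof.
apply/eqP; rewrite -subv0; apply/subvP => _ /memv_imgP[a _ ->].
by rewrite tauE (@scaler0 L V) mem0v.
Qed.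

(** [encode v] has image [G @: Lline v], and the line has the full dimension of [L] because [tau v]
    is injective. Rank-nullity for [G] on the line does the rest. *)
Lemma dim_limg_encode (v : V) : v != 0 ->
  \dim (limg (encode v)) = (\dim {:L} - \dim (lker G :&: Lline v))%N.
Proof.
move=> v_neq0; rewrite -(dim_Lline v_neq0) limg_comp.
by rewrite -(limg_ker_dim G (Lline v)) capvC addKn.
Qed.

Lemma mem_code_of (A : 'Hom(L, W)) :
  A \in code_of G <-> exists v : V, A = encode v.
Proof.
split=> [/imsetP[v _ ->] | [v ->]]; first by exists v.
by apply/imsetP; exists v.
Qed.

(** Viewing the code as the image of a linear map yields both its linearity and its dimension. *)
Lemma code_of_limg : code_of G =i limg (linfun encode).
Proof.
move=> A; apply/idP/memv_imgP => [/mem_code_of[v ->] | [v _ ->]].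
  by exists v; rewrite ?memvf // lfunE.
by rewrite lfunE; apply/mem_code_of; exists v.
Qed.

Lemma linear_code_of : linear_code (code_of G).
Proof. by exists (limg (linfun encode)); apply: code_of_limg. Qed.

Section MaximalIntersection.

Variable i : nat.
Hypothesis i_max : is_max_value (fun v : V => \dim (lker G :&: Lline v)) i.
Hypothesis lt_i : (i < \dim {:L})%N.

Lemma encode_inj : injective encode.
Proof.
move=> u v eq_uv; apply/eqP; rewrite -subr_eq0; apply/negPn/negP => uv_neq0.
have := dim_limg_encode uv_neq0.
rewrite raddfB /= eq_uv subrr (_ : limg 0 = 0%VS); last first.
  apply/eqP; rewrite -subv0; apply/subvP => _ /memv_imgP[a _ ->].
  by rewrite lfunE mem0v.
rewrite dimv0 => /esym/eqP; rewrite subn_eq0 leqNgt.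
by rewrite (leq_ltn_trans _ lt_i) //; case: i_max => _; apply.
Qed.

Lemma dim_limg_encode_full :
  \dim (limg (linfun encode)) = (\dim {:V} * \dim {:L})%N.
Proof.
rewrite limg_dim_eq ?dim_restrict // [lker _](_ : _ = 0%VS) ?capv0 //.
by apply/eqP/lker0P => u v; rewrite !lfunE; apply: encode_inj.
Qed.

(** The code is already a subspace, so spanning its enumeration adds nothing, and injectivity of
    [encode] gives it the F-dimension of [V]. *)
Lemma code_dim_code_of : code_dim (code_of G) = (\dim {:V} * \dim {:L})%N.
Proof.
rewrite -dim_limg_encode_full /code_dim; congr (\dim _).
have mem_C (A : 'Hom(L, W)) :
    (A \in (enum (code_of G) : seq 'Hom(L, W))) = (A \in limg (linfun encode)).
  rewrite -code_of_limg; exact (mem_enum (mem (code_of G)) A).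
apply/eqP; rewrite eqEsubv; apply/andP; split.
  by apply/span_subvP => A; rewrite mem_C.
by apply/subvP => A; rewrite -mem_C => /memv_span.
Qed.

Lemma card_code_of : #|code_of G| = (#|F| ^ (\dim {:V} * \dim {:L}))%N.
Proof.
rewrite card_imset; last exact: encode_inj.
rewrite -dim_restrict -(@card_vspace F (finvect_type (restrict V))).
by apply: eq_card => v; rewrite memvf.
Qed.

Lemma is_min_dist_code_of : (0 < \dim {:V})%N ->
  is_min_dist (code_of G) (\dim {:L} - i).
Proof.
case: i_max => -[v0 v0_i] le_i V_gt0; split; last first.
  move=> _ _ /mem_code_of[u ->] /mem_code_of[v ->] neq_uv.
  have uv_neq0: (u - v : V) != 0.
    by apply: contraNneq neq_uv => /eqP; rewrite subr_eq0 => /eqP->.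
  rewrite /rank_dist -raddfB /= dim_limg_encode //.
  exact: leq_sub2l.
(* The maximum ranges over all vectors, zero included. If it is attained at 0 then [i = 0], and any
   nonzero vector attains it as well. *)
have [v v_neq0 v_i]: exists2 v : V, v != 0 & \dim (lker G :&: Lline v) = i.
  have [v0_eq0|] := eqVneq v0 0; last by exists v0.
  have i_eq0: i = 0 by rewrite -v0_i v0_eq0 Lline0 capv0 dimv0.
  exists (vpick {:V}); first by rewrite vpick0 -dimv_eq0 -lt0n.
  by apply/eqP; rewrite [X in _ == X]i_eq0 -leqn0 -[X in (_ <= X)%N]i_eq0.
(* By linearity, the distance to the zero codeword is the rank of [encode v]. *)
exists (encode v), (encode 0); split.
- by apply/mem_code_of; exists v.
- by apply/mem_code_of; exists 0.
- by apply: contraNneq v_neq0 => /encode_inj->.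
- by rewrite /rank_dist -raddfB subr0 dim_limg_encode // v_i.
Qed.

End MaximalIntersection.

End CodeOf.

(** [MRD] asserts some minimum distance; uniqueness identifies it with [n - i]. *)
Lemma is_min_dist_uniq (F : finFieldType) (aT rT : vectType F)
    (C : {set finvect_type 'Hom(aT, rT)}) (d e : nat) :
  is_min_dist C d -> is_min_dist C e -> d = e.
Proof.
move=> [[A [B [A_C B_C neqAB <-]]] le_d] [[A' [B' [A'_C B'_C neqAB' <-]]] le_e].
by apply/eqP; rewrite eqn_leq le_d // le_e.
Qed.

(** Both sides of the Singleton equality are powers of [#|F| > 1], so it reduces to an equality of
    exponents, with truncated subtraction. *)
Lemma MRD_code_of (F : finFieldType) (L : fieldExtType F) (V : vectType L)
    (W : vectType F) (G : 'Hom(restrict V, W)) (i : nat) :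
  (0 < \dim {:V})%N -> (i < \dim {:L})%N ->
  is_max_value (fun v : V => \dim (lker G :&: Lline v)) i ->
  let m := \dim {:W} in let n := \dim {:L} in
  MRD (code_of G) <->
  (\dim {:V} * n = maxn m n * (minn m n - (n - i) + 1))%N.
Proof.
move=> V_gt0 lt_i i_max m n.
have d_C := is_min_dist_code_of i_max lt_i V_gt0.
have card_C := card_code_of i_max lt_i.
split=> [[d d_min] | eq_dim].
  rewrite card_C (is_min_dist_uniq d_min d_C) => /eqP.
  by rewrite eqn_exp2l ?finNzRing_gt1 // => /eqP.
by exists (n - i)%N => //; rewrite card_C eq_dim.
Qed.

Theorem theorem3p2 (q r n i : nat) (F : finFieldType) (L : fieldExtType F)
    (V : vectType L) (U : {vspace restrict V}) (W : vectType F)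
    (G : 'Hom(restrict V, W)) :
  #|F| = q ->
  (0 < r)%N -> (0 < n)%N -> ~~ odd (r * n) ->
  \dim {:L} = n ->
  \dim {:V} = r ->
  \dim U = (r * n)./2 ->
  is_max_value (fun v : V => \dim (U :&: Lline v)) i ->
  \dim {:W} = (r * n)./2 ->
  lker G = U ->
  (i < n)%N ->
  [/\ linear_code (code_of G),
      code_dim (code_of G) = (r * n)%N,
      has_parameters (code_of G) (r * n)./2 n q (n - i),
      (scattered U -> MRD (code_of G))
    & (1 < r)%N \/ n = 2%N -> MRD (code_of G) -> scattered U].
Proof.
move=> card_F r_gt0 n_gt0 even_rn dim_L dim_V dim_U i_max dim_W ker_G lt_in.
rewrite -{}ker_G in dim_U i_max *.
have lt_i: (i < \dim {:L})%N by rewrite dim_L.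
have V_gt0: (0 < \dim {:V})%N by rewrite dim_V.
have MRD_iff := MRD_code_of V_gt0 lt_i i_max.
rewrite /= dim_L dim_V dim_W in MRD_iff.
have rn_gt0: (0 < r * n)%N by rewrite muln_gt0 r_gt0.
have def_rn: (r * n = (r * n)./2 * 2)%N.
  by rewrite muln2 -[LHS]odd_double_half (negPf even_rn).
(* [U] is nonzero since rn/2 > 0, and a nonzero vector of [U] lies on its own line. *)
have i_gt0: (0 < i)%N.
  case: i_max => _ /(_ (vpick (lker G)))/(leq_trans _)-> //.
  rewrite lt0n dimv_eq0 -vpick0; apply/negP => /eqP cap0.
  have U_neq0: lker G != 0%VS.
    rewrite -dimv_eq0 dim_U -lt0n -(ltn_pmul2r (isT : 0 < 2)%N).
    by rewrite mul0n -def_rn.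
  have: vpick (lker G) \in (lker G :&: Lline (vpick (lker G)))%VS.
    by rewrite memv_cap memv_pick mem_Lline memv_line.
  move/eqP: cap0; rewrite vpick0 => /eqP->.
  by rewrite memv0 vpick0 (negPf U_neq0).
have scatteredE: scattered (lker G) <-> i = 1%N.
  case: i_max => -[v v_i] le_i; split=> [sc | i1 u _]; last by rewrite -i1.
  apply/eqP; rewrite eqn_leq i_gt0 andbT -v_i.
  have [->|/sc //] := eqVneq v 0.
  by rewrite Lline0 capv0 dimv0.
(* For r > 1 this settles which of rn/2 and n is the maximum in the Singleton bound. *)
have le_n: (1 < r)%N -> (n <= (r * n)./2)%N.
  move=> r_gt1; rewrite -(leq_pmul2r (isT : 0 < 2)%N) -def_rn mulnC.
  by rewrite leq_mul2r r_gt1 orbT.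
split.
- exact: linear_code_of.
- by rewrite (code_dim_code_of i_max) // dim_V dim_L.
- split=> //; first exact: linear_code_of.
  by rewrite -dim_L; apply: is_min_dist_code_of.
- move=> /scatteredE i1; apply/MRD_iff; rewrite i1 in lt_in *.
  case: (ltnP 1 r) => [/le_n le_nm | le_r1].
    by rewrite (maxn_idPl le_nm) (minn_idPr le_nm) subKn.
  (* For r = 1 the maximum and minimum swap: they are n and n/2, and the exponent has to be n. *)
  have -> : r = 1%N by apply/eqP; rewrite eqn_leq le_r1.
  rewrite mul1n.
  have le_hn: (n./2 <= n - 1)%N.
    rewrite leq_subRL // add1n ltn_half_double -addnn -[X in (X < _)%N]addn0.
    by rewrite ltn_add2l.
  have le_mn: (n./2 <= n)%N by apply: leq_trans le_hn (leq_subr _ _).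
  rewrite (maxn_idPr le_mn) (minn_idPl le_mn).
  (* The difference is truncated to 0 here. *)
  by move: le_hn; rewrite -subn_eq0 => /eqP->; rewrite muln1.
- move=> r_or_n /MRD_iff eq_rn; apply/scatteredE.
  case: (ltnP 1 r) => [/le_n le_nm | le_r1].
    move: eq_rn; rewrite (maxn_idPl le_nm) (minn_idPr le_nm) subKn 1?ltnW //.
    (* Cancel the positive factor rn/2 from (rn/2) * 2 = (rn/2) * (i + 1). *)
    rewrite [LHS]def_rn => /eqP; rewrite eqn_mul2l addn1 eqSS => /orP[|/eqP //].
    by rewrite eqn0Ngt (leq_trans n_gt0 le_nm).
  (* For r = 1 all of [V] is one line, so i = n/2 and the exponent equation always holds; here i = 1
     comes from 0 < i < n = 2 instead. *)
  case: r_or_n => [|n2]; first by rewrite ltnNge le_r1.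
  by apply/eqP; rewrite eqn_leq i_gt0 andbT -ltnS -n2.
Qed.
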